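(* Let $\mathbb{K}$ be a field, $S=\mathbb{K}[x_1,\dots,x_n]$, and let $I$ be an integrally closed monomial ideal in $S$. Then for every integer $m\geq 1$, we have $${\rm depth}(S/I^m)\leq {\rm depth}(S/I).$$
   Context: An ideal $I$ is integrally closed if $I=\overline{I}$, where $\overline{I}$ is the integral closure of $I$; for a monomial ideal $I$, $\overline{I}$ is the monomial ideal generated by all monomials $u\in S$ such that $u^r\in I^r$ for some integer $r\geq 1$. Depth is taken with respect to $\mathfrak{m}=(x_1,\dots,x_n)$, with the usual convention ${\rm depth}(0)=\infty$. *)

(* Defs.v *)
From HB Require Import structures.
From mathcomp Require Import all_boot all_order all_algebra.
From mathcomp Require Import boolp classical_sets mpoly.

Set Implicit Arguments.
Unset Strict Implicit.
Unset Printing Implicit Defensive.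

Import GRing.Theory.
Local Open Scope ring_scope.
Local Open Scope quotient_scope.

(* [Quotient.quot] only provides the additive group. [N] need not be proper. *)
Section QuotientModule.
Variables (R : comNzRingType) (M : lmodType R) (N : submodClosed M).

(* Submodules are closed under opposites, but mathcomp does not infer the
   [zmodClosed] structure from [submodClosed]. *)
Definition submod_pred : {pred M} := fun x => x \in N.
Fact submod_pred_closed : zmod_closed submod_pred.
Proof. exact: GRing.submod_closedB (GRing.submodClosedP N). Qed.
HB.instance Definition _ :=
  GRing.isZmodClosed.Build M submod_pred submod_pred_closed.

Definition quotmod : Type := Quotient.quot submod_pred.
HB.instance Definition _ := GRing.Zmodule.on quotmod.

Definition quotmod_pi (x : M) : quotmod := \pi_(Quotient.quot submod_pred) x.
Definition quotmod_scale (a : R) (q : quotmod) : quotmod :=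
  quotmod_pi (a *: repr (q : Quotient.quot submod_pred)).

Lemma quotmod_piP (x y : M) : quotmod_pi x = quotmod_pi y <-> x - y \in N.
Proof.
rewrite (@Quotient.idealrBE M submod_pred x y).
by split=> [h | /eqP //]; apply/eqP.
Qed.

Lemma quotmod_reprK (q : quotmod) :
  quotmod_pi (repr (q : Quotient.quot submod_pred)) = q.
Proof. exact: reprK. Qed.

Lemma quotmod_piD : {morph quotmod_pi : x y / x + y}.
Proof. by move=> x y; rewrite /quotmod_pi !piE. Qed.

Lemma quotmod_piZ a x : quotmod_scale a (quotmod_pi x) = quotmod_pi (a *: x).
Proof.
apply/quotmod_piP; rewrite -scalerBr; apply: rpredZ.
exact/quotmod_piP/quotmod_reprK.
Qed.

Fact quotmod_scaleA a b q :
  quotmod_scale a (quotmod_scale b q) = quotmod_scale (a * b) q.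
Proof. by rewrite -(quotmod_reprK q) !quotmod_piZ scalerA. Qed.

Fact quotmod_scale1 : left_id 1 quotmod_scale.
Proof. by move=> q; rewrite -(quotmod_reprK q) quotmod_piZ scale1r. Qed.

Fact quotmod_scaleDr : right_distributive quotmod_scale +%R.
Proof.
move=> a p q; rewrite -(quotmod_reprK p) -(quotmod_reprK q).
by rewrite -quotmod_piD !quotmod_piZ scalerDr quotmod_piD.
Qed.

Fact quotmod_scaleDl q : {morph quotmod_scale^~ q : a b / a + b}.
Proof.
by move=> a b; rewrite -(quotmod_reprK q) !quotmod_piZ scalerDl quotmod_piD.
Qed.

HB.instance Definition _ := GRing.Zmodule_isLmodule.Build R quotmod
  quotmod_scaleA quotmod_scale1 quotmod_scaleDr quotmod_scaleDl.

End QuotientModule.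

(* Ideals, possibly improper: [idealr] would exclude the unit ideal. *)
Notation ideal R := (submodClosed R^o).

Section Ideals.
Variable R : comNzRingType.

Definition ideal_gen (A : set R) : {pred R^o} := fun x =>
  `[< exists k (c f : 'I_k -> R), (forall i, A (f i)) /\
      x = \sum_(i < k) c i * f i >].

Fact ideal_gen_closed A : submod_closed (ideal_gen A).
Proof.
split=> [|a x y /asboolP[k [c [f [fA ->]]]] /asboolP[l [d [g [gA ->]]]]].
  by apply/asboolP; exists 0, (fun=> 0), (fun=> 0); split=> [[]//|];
    rewrite big_ord0.
pose u T (p : 'I_k -> T) (q : 'I_l -> T) i :=
  match split i with inl i => p i | inr i => q i end.
apply/asboolP; exists (k + l)%N, (u R (fun i => a * c i) d), (u R f g).
split=> [i|]; first by rewrite /u; case: (split i).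
rewrite big_split_ord /= scaler_sumr; congr (_ + _); apply: eq_bigr => i _.
  by rewrite /u (unsplitK (inl i)) -mulrA.
by rewrite /u (unsplitK (inr i)).
Qed.

HB.instance Definition _ A :=
  GRing.isSubmodClosed.Build R R^o (ideal_gen A) (ideal_gen_closed A).

Definition ideal_pow (I : ideal R) (m : nat) : ideal R :=
  ideal_gen [set x | exists f : 'I_m -> R,
    (forall i, f i \in I) /\ x = \prod_(i < m) f i].

End Ideals.

Section Depth.
Variables (R : comNzRingType) (M : lmodType R).

(* x \in (s_1, ..., s_k) M *)
Definition in_seq_mul (s : seq R) (x : M) : Prop :=
  exists y : 'I_(size s) -> M, x = \sum_(i < size s) s`_i *: y i.

(* Each s_i is a nonzerodivisor on M / (s_1, ..., s_(i-1)) M, and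
   M / (s_1, ..., s_k) M is nonzero. *)
Definition regular_seq (s : seq R) : Prop :=
  (forall i, (i < size s)%N -> forall x : M,
     in_seq_mul (take i s) (s`_i *: x) -> in_seq_mul (take i s) x) /\
  exists x : M, ~ in_seq_mul s x.

Definition regular_lengths (a : ideal R) : set nat :=
  [set k | exists s : seq R,
     [/\ size s = k, {in s, forall f, f \in a} & regular_seq s]].

(* [None] is infinity, also the value when the lengths are unbounded. *)
Definition depth (a : ideal R) : option nat :=
  if `[< forall x : M, x = 0 >] then None
  else xget None [set d | exists k, [/\ d = Some k, regular_lengths a k &
                            forall l, regular_lengths a l -> (l <= k)%N]].

End Depth.

Definition depth_le (d e : option nat) : bool :=
  match d, e with
  | _, None => true
  | None, Some _ => false
  | Some k, Some l => (k <= l)%N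
  end.

Section MonomialIdeals.
Variables (K : fieldType) (n : nat).
Local Notation S := {mpoly K[n]}.

Definition max_ideal : ideal S := ideal_gen [set x : S | exists i, x = 'X_i].

Definition monomial_ideal (I : ideal S) : Prop :=
  exists A : set 'X_{1..n},
    I =i ideal_gen [set x : S | exists2 u, A u & x = 'X_[u]].

Definition integral_closure (I : ideal S) : ideal S :=
  ideal_gen [set x : S | exists u : 'X_{1..n}, x = 'X_[u] /\
    exists r : nat, (1 <= r)%N /\ x ^+ r \in ideal_pow I r].

Definition integrally_closed (I : ideal S) : Prop := I =i integral_closure I.

End MonomialIdeals.

(* Main.v *)
Require Import Defs.
From HB Require Import structures.
From mathcomp Require Import all_boot all_order all_algebra.
From mathcomp Require Import boolp classical_sets mpoly.
From mathcomp Require Import ring.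

Set Implicit Arguments.
Unset Strict Implicit.
Unset Printing Implicit Defensive.

Import Order.TTheory GRing.Theory.
Local Open Scope ring_scope.

(** The theorem holds because [S / I] is a direct summand of [S / I ^ m] along
    the power map [phi : 'X_i |-> 'X_i ^+ m] of the polynomial ring [S].

    Let [rho] be the linear map that sends a monomial with exponent vector
    [v *+ m] to ['X_[v]] and every other monomial to 0. It is a [phi]-linear
    retraction, [rho (phi a * b) = a * rho b] and [rho 1 = 1]. The map [phi]
    sends [I] into [I ^ m], as it raises monomials to the power [m]. Conversely
    [rho] sends [I ^ m] into [I]: if ['X_[v] ^+ m] is in [I ^ m] then ['X_[v]]
    is in the integral closure of [I], hence in [I]. These inclusions persist
    when [phi g] is adjoined to [I ^ m] and [g] to [I], and through them
    multiplication by [g] is injective modulo [I] as soon as multiplication by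
    [phi g] is injective modulo [I ^ m]. Hence a sequence [t] is regular on
    [S / I] whenever [map phi t] is regular on [S / I ^ m]
    ([regular_mod_retract]).

    It remains to turn a regular sequence [f_1, .., f_l] of [S / I ^ m] in the
    maximal ideal into one of the same length that lies in the image of [phi]
    ([regular_mod_image]). Each of the quotients by [f_1, .., f_i], [i < l], has
    a nonzerodivisor in the maximal ideal, so none of its finitely many maximal
    annihilators of nonzero elements, which are prime, contains that ideal;
    neither do their preimages under [phi], because a prime containing ['X_i ^+ m] contains
    ['X_i]. Prime avoidance yields [g] in the maximal ideal such that [phi g] is
    a nonzerodivisor on all these quotients at once. Then
    [phi g, f_1, .., f_(l-1)] is again regular ([regular_exchange]), and
    induction applies modulo [phi g].

    Finiteness of the set of maximal annihilators uses that [S] is Noetherian,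
    which follows from Dickson's lemma by reduction of leading monomials
    ([mpoly_noetherian]). *)

(** * Ideals as sets *)

Section IdealSets.
Variable R : comNzRingType.
Implicit Types (J P A : set R) (s : seq R) (f g z u v : R).

(** Ideals are plain sets here because most of them arise as colons, preimages
    and extensions of other ideals. *)
Definition is_ideal J : Prop :=
  [/\ J 0, forall x y, J x -> J y -> J (x + y) & forall a x, J x -> J (a * x)].

Definition is_prime P : Prop :=
  [/\ is_ideal P, ~ P 1 & forall a b, P (a * b) -> P a \/ P b].

Lemma prime_exp P k x : is_prime P -> P (x ^+ k) -> P x.
Proof.
case=> _ P1 Pprime; elim: k => [/P1//|k IHk]; rewrite exprS.
by case/Pprime => // /IHk.
Qed.

Definition colon J u : set R := [set a | J (a * u)]%classic.

Definition nonzerodiv J z : Prop := forall x, J (z * x) -> J x.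

(** The ideal [J + (f)]. *)
Definition adjoin J f : set R := [set x | exists a, J (x - a * f)]%classic.

Lemma idealB J x y : is_ideal J -> J x -> J y -> J (x - y).
Proof. by case=> _ JD JM Jx Jy; rewrite -mulN1r; apply/JD/JM. Qed.

Lemma idealMr J a x : is_ideal J -> J x -> J (x * a).
Proof. by case=> _ _ JM Jx; rewrite mulrC; apply: JM. Qed.

Lemma ideal_sum J (I : Type) (r : seq I) (D : pred I) (F : I -> R) :
  is_ideal J -> (forall i, D i -> J (F i)) -> J (\sum_(i <- r | D i) F i).
Proof. by case=> J0 JD _ JF; elim/big_ind: _. Qed.

Lemma colon_ideal J u : is_ideal J -> is_ideal (colon J u).
Proof.
case=> J0 JD JM; split=> [|x y|a x]; rewrite /colon /= ?mul0r //.
  by rewrite mulrDl; apply: JD.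
by rewrite -mulrA; apply: JM.
Qed.

Lemma sub_adjoin J f x : J x -> adjoin J f x.
Proof. by move=> Jx; exists 0; rewrite mul0r subr0. Qed.

Lemma adjoin_ideal J f : is_ideal J -> is_ideal (adjoin J f).
Proof.
move=> idJ; have [J0 JD JM] := idJ; split=> [|x y [a Ja] [b Jb]|c x [a Ja]].
- exact: sub_adjoin.
- exists (a + b); have -> : x + y - (a + b) * f = x - a * f + (y - b * f).
    by ring.
  exact: JD.
- exists (c * a); have -> : c * x - c * a * f = c * (x - a * f) by ring.
  exact: JM.
Qed.

Lemma adjoinC J f g : adjoin (adjoin J f) g = adjoin (adjoin J g) f.
Proof.
have sub f1 g1 x : adjoin (adjoin J f1) g1 x -> adjoin (adjoin J g1) f1 x.
  by case=> a [b Jx]; exists b, a; rewrite addrAC.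
by rewrite predeqE => x; split; apply: sub.
Qed.

Lemma adjoin_seq_sub J A s : is_ideal A -> (forall x, J x -> A x) ->
  {in s, forall f, A f} -> forall x, foldl adjoin J s x -> A x.
Proof.
move=> idA; have [_ AD AM] := idA.
elim: s J => [|f s IHs] J sJA As //=; apply: IHs => [x [a Jx]|g gs].
  rewrite -(subrK (a * f) x); apply: AD; first exact: sJA.
  by apply: AM; apply: As; apply: mem_head.
by apply: As; rewrite inE gs orbT.
Qed.

(** A prime that contains none of the ideals [Qs] does not contain their
    intersection: a product of elements outside [P], one from each ideal, is
    again outside [P]. *)
Lemma common_witness (Qs : seq (set R)) P : is_prime P ->
  (forall Q, Q \in Qs -> is_ideal Q /\ exists2 x, Q x & ~ P x) ->
  exists2 c, (forall Q, Q \in Qs -> Q c) & ~ P c.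
Proof.
case=> idP P1 PM; elim: Qs => [_|Q Qs IHQs Qsx]; first by exists 1.
have [|c Qsc Pc] := IHQs.
  by move=> Q1 Q1s; apply: Qsx; rewrite inE Q1s orbT.
have [idQ [x Qx Px]] := Qsx Q (mem_head _ _).
exists (x * c) => [Q1|/PM[]//]; rewrite inE => /predU1P[->|Q1s].
  exact: idealMr.
have [|[_ _ Q1M] _] := Qsx Q1; first by rewrite inE Q1s orbT.
by apply: Q1M; apply: Qsc.
Qed.

(** By induction on the number of primes. If no prime of the tail is contained
    in [P], an element [g] that avoids the tail but lies in [P] is corrected by
    an element of [A] that lies in every prime of the tail and not in [P]. *)
Lemma prime_avoidance A (Ps : seq (set R)) : is_ideal A ->
  (forall P, P \in Ps -> is_prime P /\ exists2 a, A a & ~ P a) ->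
  exists2 g, A g & forall P, P \in Ps -> ~ P g.
Proof.
move=> idA; have [A0 AD AM] := idA.
elim: {Ps}(size Ps) {-2}Ps (eqxx (size Ps)) => [|k IHk] [|P Ps]//=.
- by move=> _ _; exists 0.
- rewrite eqSS => /eqP szPs primes.
have [[Q Qs /= sQP]|incomparable] :=
  pselect (exists2 Q, Q \in Ps & forall x, Q x -> P x).
  (* Avoiding [P] avoids [Q] as well, so [Q] can be dropped from the list. *)
  have [|R1 /=|g Ag avoid] := IHk (P :: rem Q Ps).
  - by rewrite /= size_rem // -szPs prednK //; case: (Ps) Qs.
  - rewrite inE => R1s; apply: primes; rewrite inE.
    by case/orP: R1s => [->//|/mem_rem->]; rewrite orbT.
  exists g => // R1; have nPg : ~ P g by apply: avoid; apply: mem_head.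
  rewrite inE => /predU1P[->//|R1s].
  have [->|neq] := eqVneq R1 Q; first by move/sQP.
  apply: avoid; rewrite inE; apply/orP; right.
  by have := perm_mem (perm_to_rem Qs) R1; rewrite R1s inE (negPf neq).
have [||g Ag avoid] := IHk Ps; first exact/eqP.
  by move=> Q Qs; apply: primes; rewrite inE Qs orbT.
have [Pg|nPg] := pselect (P g); last first.
  by exists g => // Q; rewrite inE => /predU1P[->|/avoid].
have [primeP [a Aa nPa]] := primes P (mem_head _ _).
have [|h Qsh nPh] := @common_witness (A :: Ps) P primeP.
  move=> Q; rewrite inE => /predU1P[->|Qs]; first by split=> //; exists a.
  have [|[idQ _ _] _] := primes Q; first by rewrite inE Qs orbT.
  split=> //.
  apply: contrapT => noQ; apply: incomparable; exists Q => // x Qx.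
  by apply: contrapT => nPx; apply: noQ; exists x.
exists (g + h) => [|Q]; first by apply: AD => //; exact: Qsh (mem_head _ _).
have addl T x y : is_ideal T -> T (x + y) -> T y -> T x.
  by move=> idT Txy Ty; rewrite -(addrK y x); apply: idealB.
rewrite inE => /predU1P[->|Qs Qgh].
  have [idP _ _] := primeP.
  by rewrite addrC => Phg; apply: nPh; apply: addl Phg Pg.
have [|[idQ _ _] _] := primes Q; first by rewrite inE Qs orbT.
apply: (avoid Q Qs); apply: addl Qgh _ => //; apply: Qsh.
by rewrite inE Qs orbT.
Qed.

(** * Zero divisors in Noetherian rings *)

(** The ascending chain condition, phrased without naming generated ideals:
    in every sequence some term lies in the ideal generated by its
    predecessors. *)
Definition noetherian : Prop :=
  forall a : nat -> R, exists n, forall J, is_ideal J ->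
    (forall i, (i < n)%N -> J (a i)) -> J (a n).

(** [colon J v] is maximal among the annihilators of nonzero elements modulo
    [J]; such annihilators are prime ([max_colon_prime]). *)
Definition max_colon J v : Prop :=
  ~ J v /\ forall w, ~ J w -> (forall a, J (a * v) -> J (a * w)) ->
  forall a, J (a * w) -> J (a * v).

Lemma max_colon_prime J v : is_ideal J -> max_colon J v -> is_prime (colon J v).
Proof.
move=> idJ [nJv maxv]; have [J0 JD JM] := idJ.
split; [exact: colon_ideal|by rewrite /colon /= mul1r|move=> a b].
rewrite /colon /= -mulrA => Jabv.
have [?|nJbv] := pselect (J (b * v)); [by right|left].
by apply: maxv nJbv _ _ Jabv => c Jcv; rewrite mulrCA; apply: JM.
Qed.

(** Otherwise the annihilators [colon J v] of suitable elements [v k] would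
    increase strictly with [k], and picking a new element at each step would
    give a sequence that contradicts the chain condition. *)
Lemma max_colon_above J u : noetherian -> is_ideal J -> ~ J u ->
  exists2 v, max_colon J v & forall a, J (a * u) -> J (a * v).
Proof.
move=> noeth idJ nJu; apply: contrapT => nomax.
pose above v := ~ J v /\ forall a, J (a * u) -> J (a * v).
have /choice[next nextP] v : exists wa : R * R, above v ->
    [/\ above wa.1, forall a, J (a * v) -> J (a * wa.1),
        J (wa.2 * wa.1) & ~ J (wa.2 * v)].
  apply: contrapT => noext; apply: nomax.
  have [[nJv upv]|nab] := pselect (above v); last first.
    by case: noext; exists (0, 0).
  exists v => //; split=> // w nJw vw a Jaw; apply: contrapT => nJav.
  apply: noext; exists (w, a) => _; split=> //; split=> // b Jbu.
  by apply: vw; apply: upv.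
pose v k := iter k (fun x => (next x).1) u.
have abv k : above (v k).
  by elim: k => [|k IHk]; [split | have [] := nextP _ IHk].
have mono i k a : (i <= k)%N -> J (a * v i) -> J (a * v k).
  move=> /subnK <-; elim: (k - i)%N => // d IHd Ja.
  by have [_ up _ _] := nextP _ (abv (d + i)%N); apply: up; apply: IHd.
have [k Jk] := noeth (fun k => (next (v k)).2).
have [_ _ _ nJk] := nextP _ (abv k); apply: nJk.
apply: (Jk (colon J (v k))) => [|i ltik]; first exact: colon_ideal.
by apply: (mono i.+1); last by have [] := nextP _ (abv i).
Qed.

(** Suppose that no finite list works. Then there are [v k] with maximal
    annihilators such that [colon J (v k)] is contained in none of the previous
    ones, hence by maximality contains none of them. Being prime, it misses some
    [c] in all the previous ones. This [c] annihilates the previous [v i]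
    modulo [J] but not [v k], so [v k] is not in the ideal that they
    generate. *)
Lemma finite_max_colons J : noetherian -> is_ideal J ->
  exists2 s : seq R, (forall v, v \in s -> max_colon J v) &
    forall z, ~ nonzerodiv J z -> exists2 v, v \in s & J (z * v).
Proof.
move=> noeth idJ; apply: contrapT => infinite.
have /choice[f fP] s : exists vz : R * R,
    (forall v, v \in s -> max_colon J v) ->
    [/\ max_colon J vz.1, J (vz.2 * vz.1)
      & forall v, v \in s -> ~ J (vz.2 * v)].
  apply: contrapT => noext; apply: infinite.
  have [maxs|nmaxs] := pselect (forall v, v \in s -> max_colon J v); last first.
    by case: noext; exists (0, 0).
  exists s => // z zdiv; apply: contrapT => fresh; apply: zdiv => u Jzu.
  apply: contrapT => nJu; have [v maxv uv] := max_colon_above noeth idJ nJu.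
  apply: noext; exists (v, z) => _; split=> //=; first exact: uv.
  by move=> w ws Jzw; apply: fresh; exists w.
pose L k := iter k (fun s => (f s).1 :: s) [::].
pose v k := (f (L k)).1.
have maxL k : forall w, w \in L k -> max_colon J w.
  elim: k => [|k IHk] w //=; rewrite inE => /predU1P[->|]; last exact: IHk.
  by have [] := fP _ IHk.
have inL i k : (i < k)%N -> v i \in L k.
  elim: k => // k IHk; rewrite ltnS leq_eqVlt inE => /predU1P[->|/IHk ->].
    by rewrite eqxx.
  by rewrite orbT.
have [k Jk] := noeth v; have [maxk Jzk nJz] := fP _ (maxL k).
have [[nJvk _] primek] := (maxk, max_colon_prime idJ maxk).
have [|c Lc nJcv] := @common_witness [seq colon J w | w <- L k] _ primek.
  move=> _ /mapP[w wL ->]; split; first exact: colon_ideal.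
  apply: contrapT => sub; have [nJw maxw] := maxL k w wL.
  apply: (nJz w wL); apply: (maxw _ nJvk _ _ Jzk) => a Jaw.
  by apply: contrapT => nJav; apply: sub; exists a.
apply: nJcv; rewrite /colon /= mulrC; apply: (Jk (colon J c)) => [|i ltik].
  exact: colon_ideal.
rewrite /colon /= mulrC; apply: (Lc (colon J (v i))).
by apply: map_f; apply: inL.
Qed.

Lemma prime_cover J : noetherian -> is_ideal J ->
  exists Ps : seq (set R),
    (forall P, P \in Ps -> is_prime P /\
       forall f, nonzerodiv J f -> ~ P f) /\
    forall z, ~ nonzerodiv J z -> exists2 P, P \in Ps & P z.
Proof.
move=> noeth idJ; have [s maxs cover] := finite_max_colons noeth idJ.
exists [seq colon J v | v <- s]; split=> [_ /mapP[v vs ->]|z /cover[v vs Jzv]].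
  split; first exact: max_colon_prime (maxs v vs).
  by move=> f nzf Jfv; have [nJv _] := maxs v vs; by apply: nJv; apply: nzf.
by exists (colon J v) => //; apply: map_f.
Qed.

(** Avoiding finitely many primes is enough to be a nonzerodivisor modulo
    several ideals at once; no prime of the list contains [A], because [A]
    contains a nonzerodivisor modulo each of the ideals. *)
Lemma prime_cover_seq (Js : seq (set R)) A : noetherian ->
    (forall J, J \in Js -> is_ideal J /\ exists2 f, A f & nonzerodiv J f) ->
  exists Ps : seq (set R),
    (forall P, P \in Ps -> is_prime P /\ exists2 f, A f & ~ P f) /\
    forall z, (forall P, P \in Ps -> ~ P z) ->
      forall J, J \in Js -> nonzerodiv J z.
Proof.
move=> noeth; elim: Js => [_|J Js IHJs JsP]; first by exists [::].
have [|Ps [PsP cover]] := IHJs.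
  by move=> J1 J1s; apply: JsP; rewrite inE J1s orbT.
have [idJ [f Af nzf]] := JsP J (mem_head _ _).
have [Qs [QsP Qcover]] := prime_cover noeth idJ.
exists (Qs ++ Ps); split=> [P|z avoid J1].
  rewrite mem_cat => /orP[/QsP[primeP nz]|/PsP//].
  by split=> //; exists f => //; apply: nz.
rewrite inE => /predU1P[->|]; last first.
  by apply: cover => P Ps1; apply: avoid; rewrite mem_cat Ps1 orbT.
by apply: contrapT => /Qcover[P Qs1]; apply: avoid; rewrite mem_cat Qs1.
Qed.

(** * Regular sequences modulo an ideal *)

(** Regularity on the quotient by [J], without the condition that the quotient
    by the whole sequence is nonzero. *)
Fixpoint regular_mod J s : Prop :=
  if s is f :: s' then nonzerodiv J f /\ regular_mod (adjoin J f) s' else True.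

(** The successive ideals modulo which the members of [s] are to be
    nonzerodivisors; [J + (s)] itself is not among them. *)
Fixpoint stages J s : seq (set R) :=
  if s is f :: s' then J :: stages (adjoin J f) s' else [::].

Lemma stagesP J A s : is_ideal J -> regular_mod J s -> {in s, forall f, A f} ->
  forall J', J' \in stages J s ->
    is_ideal J' /\ exists2 f, A f & nonzerodiv J' f.
Proof.
elim: s J => [|f s IHs] J //= idJ [nzf regs] As J'.
rewrite inE => /predU1P[->|].
  by split=> //; exists f => //; exact: As (mem_head _ _).
apply: IHs => //; first exact: adjoin_ideal.
by move=> g gs; apply: As; rewrite inE gs orbT.
Qed.

(** A nonzerodivisor on all intermediate quotients can be put in front of the
    sequence in exchange for its last member: [z] is regular at every stage, and
    two elements [f], [z] with [f] regular on a module and [z] regular on the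
    module and on its quotient by [f] can be swapped. *)
Lemma regular_exchange J f s z : is_ideal J -> regular_mod J (f :: s) ->
    (forall J', J' \in stages J (f :: s) -> nonzerodiv J' z) ->
  regular_mod J (z :: belast f s).
Proof.
move=> idJ reg nz; split; first exact: nz (mem_head _ _).
elim: s f J idJ reg nz => [|g s IHs] f J idJ // [nzf reg] nz.
have [_ _ JM] := idJ; split=> [x [a Jfxz]|].
  have [b Jab] : adjoin J f a.
    apply: (nz (adjoin J f)); first by rewrite !inE eqxx orbT.
    exists x; rewrite -[X in J X]opprK opprB -mulN1r.
    by rewrite (mulrC x) (mulrC z); apply: JM.
  exists b; apply: nzf; have -> : f * (x - b * z) =
    f * x - a * z + z * (a - b * f) by ring.
  by have [_ JD _] := idJ; apply: JD => //; apply: JM.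
rewrite adjoinC; apply: IHs => //; first exact: adjoin_ideal.
by move=> J' J's; apply: nz; rewrite inE J's orbT.
Qed.

End IdealSets.

Section RingMorphism.
Variables (S R : comNzRingType) (phi : {rmorphism S -> R}).

Lemma preimage_prime (P : set R) :
  is_prime P -> is_prime [set a | P (phi a)]%classic.
Proof.
case=> [[P0 PD PM] P1 Pprime]; split; rewrite /= ?rmorph1 //.
  split=> /= [|x y Px Py|a x Px]; rewrite ?rmorph0 ?rmorphD ?rmorphM //.
    exact: PD.
  exact: PM.
by move=> a b; rewrite /= rmorphM; apply: Pprime.
Qed.

(** The hypothesis on primes says that the ideal generated by the image of [A]
    has [B] in its radical. It makes the preimages of the primes to be avoided
    fail to contain [A]. *)
Lemma regular_mod_image (A : set S) (B J : set R) (s : seq R) :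
    noetherian R -> is_ideal A ->
    (forall P, is_prime P -> (forall a, A a -> P (phi a)) ->
       forall b, B b -> P b) ->
    is_ideal J -> regular_mod J s -> {in s, forall f, B f} ->
  exists t, [/\ size t = size s, {in t, forall f, A f} &
                regular_mod J (map phi t)].
Proof.
move=> noeth idA lies_over.
elim: {s}(size s) {-2}s (eqxx (size s)) J => [|k IHk] [|f s] // szs J idJ reg Bs.
  by exists [::].
have [Ps [PsP nz]] := prime_cover_seq noeth (stagesP idJ reg Bs).
have [_ /mapP[P Ps1 ->]|g Ag avoid] :=
    @prime_avoidance S A [seq [set a | P (phi a)]%classic | P <- Ps] idA.
  have [primeP [b Bb nPb]] := PsP P Ps1.
  split; first exact: preimage_prime.
  apply: contrapT => sub; apply: nPb; apply: (lies_over P) => // a Aa.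
  by apply: contrapT => nPa; apply: sub; exists a.
have [J' J's|nzg regs] := regular_exchange (z := phi g) idJ reg.
  apply: (nz _ _ J' J's) => Q Qs; apply: (avoid [set a | Q (phi a)]%classic).
  by apply/mapP; exists Q.
have [|||t [szt At regt]] := IHk (belast f s) _ (adjoin J (phi g)) _ regs.
- by rewrite size_belast.
- exact: adjoin_ideal.
- by move=> h /mem_belast hs; apply: Bs.
exists (g :: t); split=> [|h|//]; first by rewrite /= szt size_belast.
by rewrite inE => /predU1P[->|/At].
Qed.

(** The pairs of ideals exchanged by [phi] and [rho] are stable under adjoining
    [g] on one side and [phi g] on the other, so the induction runs over all
    such pairs. *)
Lemma regular_mod_retract (rho : R -> S) (I : set S) (J : set R) (t : seq S) :
    {morph rho : x y / x - y} -> (forall a b, rho (phi a * b) = a * rho b) ->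
    rho 1 = 1 ->
    (forall a, I a -> J (phi a)) -> (forall b, J b -> I (rho b)) ->
  regular_mod J (map phi t) -> regular_mod I t.
Proof.
move=> rhoB rhoM rho1; elim: t I J => [|g t IHt] I J //= IJ JI [nzg regt].
have rhoK a : rho (phi a) = a by rewrite -[phi a]mulr1 rhoM rho1 mulr1.
split=> [a /IJ|].
  by rewrite rmorphM => /nzg/JI; rewrite rhoK.
apply: IHt regt => [x [a /IJ]|b [a /JI Ib]].
  by rewrite rmorphB rmorphM => Jx; exists (phi a).
by exists (rho a); move: Ib; rewrite rhoB mulrC rhoM mulrC.
Qed.

End RingMorphism.

(** * Polynomial rings are Noetherian *)

(** The subsequence visits indices at which [f] is minimal among all later
    values. *)
Lemma nondecreasing_subsequence (f : nat -> nat) :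
  exists s : nat -> nat, {homo s : i j / (i < j)%N} /\
                         {homo (f \o s) : i j / (i <= j)%N}.
Proof.
have /choice[g gP] N : exists k, (N <= k)%N /\
    forall l, (N <= l)%N -> (f k <= f l)%N.
  have ex : exists y, `[< exists2 k, (N <= k)%N & f k = y >].
    by exists (f N); apply/asboolP; exists N.
  case: (ex_minnP ex) => y /asboolP[k leNk <-] miny; exists k; split=> // l leNl.
  by apply: miny; apply/asboolP; exists l.
pose s := fix s k := if k is k'.+1 then g (s k').+1 else g 0%N.
have ltS k : (s k < s k.+1)%N by have [] := gP (s k).+1.
have leS k : (f (s k) <= f (s k.+1))%N.
  have [N [leN sE]] : exists N, (N <= s k)%N /\ s k = g N.
    by case: k => [|k]; [exists 0%N | exists (s k).+1; have [] := gP (s k).+1].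
  by rewrite {1}sE; have [_] := gP N; apply; apply/ltnW/(leq_ltn_trans leN).
exists s; split; first exact: homo_ltn ltn_trans ltS.
by apply: homo_leq leS => // x y z; apply: leq_trans.
Qed.

(** Passing to a subsequence once for each variable makes all the exponents
    nondecreasing. *)
Lemma dickson n (u : nat -> 'X_{1..n}) :
  exists i j, (i < j)%N /\ (u i <= u j)%MM.
Proof.
have monotone_on k : exists s : nat -> nat, {homo s : i j / (i < j)%N} /\
    forall c : 'I_n, (c < k)%N ->
      {homo (fun i => u (s i) c) : i j / (i <= j)%N}.
  elim: k => [|k [s [incs nd]]]; first by exists id; split=> // c; rewrite ltn0.
  have [ltkn|lenk] := ltnP k n; last first.
    by exists s; split=> // c _; apply: nd; apply: leq_trans lenk.
  have [t [inct ndt]] := nondecreasing_subsequence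
    (fun i => u (s i) (Ordinal ltkn)).
  exists (s \o t); split=> [i j /inct/incs //|c].
  rewrite ltnS leq_eqVlt => /predU1P[ck|/nd ndc] i j leij.
    have -> : c = Ordinal ltkn by apply: val_inj.
    exact: ndt.
  by apply: ndc; move: leij; apply: (ltnW_homo inct).
have [s [incs nd]] := monotone_on n.
exists (s 0%N), (s 1%N); split; first exact: incs.
by apply/mnm_lepP => c; apply: (nd c (ltn_ord c) 0%N 1%N).
Qed.

Section Polynomials.
Variables (K : fieldType) (n : nat).
Local Notation S := {mpoly K[n]}.

Lemma lead_reduction (p q : S) : q != 0 -> (mlead q <= mlead p)%MM ->
  exists a, p - a * q != 0 -> (mlead (p - a * q) < mlead p)%O.
Proof.
move=> q0 le_qp; have [->|p0] := eqVneq p 0.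
  by exists 0; rewrite mul0r subr0 eqxx.
pose c := p@_(mlead p) / q@_(mlead q).
have lcq : q@_(mlead q) != 0 by rewrite mleadc_eq0.
have c0 : c != 0 by rewrite mulf_neq0 ?invr_eq0 ?mleadc_eq0.
pose t : S := c *: 'X_[mlead p - mlead q].
have lead_t : mlead t = (mlead p - mlead q)%MM by rewrite mleadZ // mleadXm.
have t0 : t != 0.
  by rewrite -mleadc_eq0 lead_t mcoeffZ mcoeffX eqxx mulr1.
exists t; set r := p - _ => r0.
have le_rp : (mlead r <= mlead p)%O.
  apply: le_trans (mleadB_le _ _) _.
  by rewrite mleadM // lead_t submK // joinxx.
rewrite lt_neqAle le_rp andbT; apply: contraNneq r0 => eq_rp.
rewrite -mleadc_eq0 eq_rp /r mcoeffB -{2}(submK le_qp) -lead_t mleadcM lead_t.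
by rewrite mcoeffZ mcoeffX eqxx mulr1 /c mulfVK ?subrr.
Qed.

(** In a bad sequence [a], choose [b k] with the least leading monomial in the
    coset of [a k] modulo the ideal [hull k] of the preceding terms. By
    Dickson's lemma the leading monomial of some [b i] divides that of a later [b j], and
    reducing [b j] by [b i] contradicts the choice of [b j]. *)
Lemma mpoly_noetherian : noetherian S.
Proof.
move=> a; apply: contrapT => bad.
pose hull k : set S := [set x | forall J, is_ideal J ->
  (forall i, (i < k)%N -> J (a i)) -> J x]%classic.
have hull_ideal k : is_ideal (hull k).
  split=> [J [J0 _ _] _ //|x y Hx Hy J idJ Ja|b x Hx J idJ Ja].
    by have [_ JD _] := idJ; apply: JD; [apply: Hx | apply: Hy].
  by have [_ _ JM] := idJ; apply: JM; apply: Hx.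
have hull_mono i k x : (i <= k)%N -> hull i x -> hull k x.
  by move=> leik Hx J idJ Ja; apply: Hx => // j ltji; apply/Ja/(leq_trans ltji).
have nota k : ~ hull k (a k).
  by move=> Hk; apply: bad; exists k => J idJ Ja; apply: Hk.
have /choice[b bP] k : exists b, hull k (a k - b) /\
    forall b', hull k (a k - b') -> ~ (mlead b' < mlead b)%O.
  suff descent l c : mlead c = l -> hull k (a k - c) -> exists b,
      hull k (a k - b) /\
      forall b', hull k (a k - b') -> ~ (mlead b' < mlead b)%O.
    by apply: (descent _ (a k) erefl); rewrite subrr; have [] := hull_ideal k.
  elim/(well_founded_ind (@ltom_wf n)): l c => l IHl b lE Hb.
  have [[b' Hb' lt]|min] :=
    pselect (exists2 b', hull k (a k - b') & (mlead b' < mlead b)%O).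
    by apply: (IHl (mlead b') _ b') => //; rewrite -lE.
  by exists b; split=> // b' Hb' lt; apply: min; exists b'.
have b0 k : b k != 0.
  apply/eqP => bk; have [Hk _] := bP k; apply: (nota k).
  by rewrite bk subr0 in Hk.
have [i [j [ltij le_lead]]] := dickson (fun k => mlead (b k)).
have [c red] := lead_reduction (b0 i) le_lead.
have [_ HD HM] := hull_ideal j.
have Hbi : hull j (b i).
  have Hai : hull j (a i) by move=> J _ Ja; apply: Ja.
  rewrite -(subKr (a i) (b i)); apply: (idealB (hull_ideal j) Hai).
  by apply: hull_mono (ltnW ltij) _; have [] := bP i.
have Hred : hull j (a j - (b j - c * b i)).
  rewrite opprB addrA addrAC; apply: HD; first by have [] := bP j.
  exact: HM.
have [_ minb] := bP j; apply: (minb _ Hred); apply: red.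
by apply: contra_notN (nota j) => /eqP red0; rewrite red0 subr0 in Hred.
Qed.

End Polynomials.
(** * Depth of a cyclic module *)

Section Depth.
Variable R : comNzRingType.
Implicit Types (I : ideal R) (s : seq R).

Definition ideal_set I : set R := [set x | x \in I]%classic.

Lemma ideal_setP I : is_ideal (ideal_set I).
Proof.
split=> [|x y Ix Iy|a x Ix]; rewrite /ideal_set /=; first exact: rpred0.
  exact: (rpredD Ix Iy).
exact: (rpredZ a Ix).
Qed.

Lemma ideal_gen_min (A J : set R) : is_ideal J -> (forall x, A x -> J x) ->
  forall x, x \in ideal_gen A -> J x.
Proof.
move=> idJ AJ _ /asboolP[k [c [f [Af ->]]]].
by apply: ideal_sum => // i _; have [_ _] := idJ; apply; apply: AJ.
Qed.

Lemma mem_ideal_gen (A : set R) x : A x -> x \in ideal_gen A.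
Proof.
move=> Ax; apply/asboolP; exists 1%N, (fun=> 1), (fun=> x); split=> //.
by rewrite big_ord1 mul1r.
Qed.

Lemma adjoin_seqE (J : set R) s x :
  foldl (@adjoin R) J s x <->
  exists y : nat -> R, J (x - \sum_(i < size s) s`_i * y i).
Proof.
elim: s J => [|f s IHs] J /=.
  by split=> [Jx|[y]]; [exists (fun=> 0) |]; rewrite big_ord0 subr0.
rewrite IHs; split=> [[y [a Jy]]|[y Jy]].
  exists (fun i => if i is j.+1 then y j else a).
  by rewrite big_ord_recl /= opprD addrA addrAC (mulrC f).
exists (y \o S), (y 0%N).
by rewrite big_ord_recl /= opprD addrA addrAC (mulrC f) in Jy.
Qed.

Lemma quotmod_pi0 I : quotmod_pi I 0 = 0.
Proof. by rewrite -[RHS](scale0r (quotmod_pi I 0)) [RHS]quotmod_piZ scale0r. Qed.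

Lemma in_seq_mul_quotmod I s x :
  in_seq_mul s (quotmod_pi I x) <-> foldl (@adjoin R) (ideal_set I) s x.
Proof.
have piS (y : nat -> R) : \sum_(i < size s) s`_i *: quotmod_pi I (y i) =
    quotmod_pi I (\sum_(i < size s) s`_i * y i).
  rewrite (big_morph _ (@quotmod_piD _ _ I) (quotmod_pi0 I)).
  by apply: eq_bigr => i _; apply: quotmod_piZ.
rewrite adjoin_seqE; split=> [[y xE]|[y Ixy]]; last first.
  by exists (fun i => quotmod_pi I (y i)); rewrite piS; apply/quotmod_piP.
pose z i : R := if insub i is Some j then repr (y j) else 0.
exists z; apply/quotmod_piP; rewrite -(piS z) xE; apply: eq_bigr => i _.
by rewrite /z valK quotmod_reprK.
Qed.

Lemma regular_modE (J : set R) s : regular_mod J s <->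
  forall i, (i < size s)%N -> nonzerodiv (foldl (@adjoin R) J (take i s)) s`_i.
Proof.
elim: s J => [|f s IHs] J //=; rewrite IHs.
split=> [[nzf nzs] [|i]|nzs]; [by rewrite take0|exact: nzs|split].
  exact: (nzs 0%N).
by move=> i ltis; apply: (nzs i.+1).
Qed.

Lemma regular_seq_quotmod I s : regular_seq (quotmod I) s <->
  regular_mod (ideal_set I) s /\ ~ foldl (@adjoin R) (ideal_set I) s 1.
Proof.
rewrite /regular_seq regular_modE; split=> [[reg [q nq]]|[reg n1]].
  split=> [i ltis x|s1].
    move/in_seq_mul_quotmod => Hx; apply/in_seq_mul_quotmod/reg => //.
    by rewrite [_ *: _]quotmod_piZ.
  apply: nq; rewrite -(quotmod_reprK q); apply/in_seq_mul_quotmod.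
  move: s1 => /adjoin_seqE[y Iy]; apply/adjoin_seqE.
  exists (fun i => repr q * y i); have [_ _ IM] := ideal_setP I.
  have := IM (repr q) _ Iy; rewrite mulrBr mulr1 mulr_sumr.
  by under eq_bigr do rewrite mulrCA.
split=> [i ltis q|]; last by exists (quotmod_pi I 1); move/in_seq_mul_quotmod.
rewrite -(quotmod_reprK q) [_ *: _]quotmod_piZ => /in_seq_mul_quotmod Hq.
by apply/in_seq_mul_quotmod/reg.
Qed.

Lemma quotmod_eq0 I : (forall q : quotmod I, q = 0) <-> 1 \in I.
Proof.
split=> [/(_ (quotmod_pi I 1))|I1 q].
  by rewrite -(quotmod_pi0 I) => /quotmod_piP; rewrite subr0.
rewrite -(quotmod_reprK q) -(quotmod_pi0 I); apply/quotmod_piP; rewrite subr0.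
by have [_ _ IM] := ideal_setP I; rewrite -[repr _]mulr1; apply: IM.
Qed.

(** Comparing lengths is enough in spite of the two conventions in [depth]: it
    is infinite for the zero module, which the hypothesis on 1 handles, and for
    unbounded lengths, which for [J] would be unbounded for [I] too. *)
Lemma depth_le_regular (A I J : ideal R) : (1 \in J -> 1 \in I) ->
    (forall l, regular_lengths (quotmod J) A l ->
               regular_lengths (quotmod I) A l) ->
  depth_le (depth (quotmod J) A) (depth (quotmod I) A).
Proof.
move=> JI sub; rewrite {2}/depth.
have le_None d : depth_le d None by case: d.
case: (asboolP (forall x : quotmod I, x = 0)) => // /quotmod_eq0 nI.
case: xgetP => [_ _ [e [-> _ ub]]|//].
rewrite /depth asboolF; last by move/quotmod_eq0 => /JI.
have len0 : regular_lengths (quotmod J) A 0%N.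
  exists [::]; split=> //; apply/regular_seq_quotmod; split=> //= J1.
  by apply: nI; apply: JI.
have [k lenk ubk] : exists2 k, regular_lengths (quotmod J) A k &
    forall l, regular_lengths (quotmod J) A l -> (l <= k)%N.
  have ex : exists k, `[< regular_lengths (quotmod J) A k >].
    by exists 0%N; apply/asboolP.
  have ubJ l : `[< regular_lengths (quotmod J) A l >] -> (l <= e)%N.
    by move/asboolP => /sub /ub.
  case: (ex_maxnP ex ubJ) => k /asboolP lenk maxk; exists k => // l lenl.
  by apply: maxk; apply/asboolP.
case: xgetP => [d' _ [l [-> lenl _]]|/(_ (Some k)) []]; first exact/ub/sub.
by exists k.
Qed.

End Depth.

(** * Monomial ideals *)

Section Monomial.
Variables (K : fieldType) (n : nat).
Local Notation S := {mpoly K[n]}.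
Implicit Types (I J : ideal S) (p : S) (u v : 'X_{1..n}).

(** For ideals this is equivalent to being generated by monomials, and it is the
    form in which that property is used. *)
Definition support_closed I : Prop :=
  forall p u, p \in I -> u \in msupp p -> 'X_[u] \in I.

(** This ideal reduces the closure of the support to a verification on
    generators. *)
Lemma support_ideal I :
  is_ideal [set p : S | forall u, u \in msupp p -> 'X_[u] \in I]%classic.
Proof.
split=> [u|p q Ip Iq u|a p Ip u] /=; first by rewrite msupp0.
  by move/msuppD_le; rewrite mem_cat => /orP[/Ip|/Iq].
move/msuppM_le => /allpairsP[[v w] /= [_ /Ip Iw ->]].
by rewrite mpolyXD; have [_ _ IM] := ideal_setP I; apply: IM.
Qed.

Lemma monomial_support_closed I : monomial_ideal I -> support_closed I.
Proof.
case=> A IA p u pI; move: u; rewrite IA in pI.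
apply: (ideal_gen_min (support_ideal I) _ pI) => _ [w Aw ->] v.
rewrite msuppX inE => /eqP->.
by rewrite IA; apply: mem_ideal_gen; exists w.
Qed.

Lemma ideal_powMr I k p q : p \in ideal_pow I k -> q \in I ->
  p * q \in ideal_pow I k.+1.
Proof.
move=> Ip Iq; have idk := ideal_setP (ideal_pow I k.+1).
apply: (@ideal_gen_min _ _ [set p | p * q \in ideal_pow I k.+1]%classic _ _ _ Ip).
  have [I0 ID IM] := idk; split=> [|x y|a x] /=; rewrite ?mul0r //.
    by rewrite mulrDl; apply: ID.
  by rewrite -mulrA; apply: IM.
move=> _ [f [If ->]] /=; apply: mem_ideal_gen.
exists (fun i => if unlift ord_max i is Some j then f j else q).
split=> [i|]; first by case: unliftP.
rewrite big_ord_recr /= unlift_none; congr (_ * _); apply: eq_bigr => i _.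
rewrite -[widen_ord _ _](_ : lift ord_max i = _) ?liftK //.
exact/val_inj/lift_max.
Qed.

Lemma support_closed_pow I k : support_closed I -> support_closed (ideal_pow I k).
Proof.
move=> suppI p u pIk; move: u.
apply: (ideal_gen_min (support_ideal (ideal_pow I k)) _ pIk).
move=> _ [f [If ->]] /=; elim: k f If {pIk} => [|k IHk] f If u.
  rewrite big_ord0 msupp1 inE => /eqP->; apply: mem_ideal_gen.
  by exists (fun=> 0); split=> [[]//|]; rewrite big_ord0 mpolyX0.
rewrite big_ord_recr /= => /msuppM_le/allpairsP[[v w] /= [vs ws ->]].
rewrite mpolyXD; apply: ideal_powMr; last exact: suppI ws.
by apply: IHk vs => i; apply: If.
Qed.

Lemma ideal_pow_sub I k p : (0 < k)%N -> p \in ideal_pow I k -> p \in I.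
Proof.
case: k => // k _; apply: (ideal_gen_min (ideal_setP I)) => _ [f [If ->]].
rewrite big_ord_recl; apply: idealMr (ideal_setP I) _; exact: If.
Qed.

Lemma exp_ideal_pow I k p : p \in I -> p ^+ k \in ideal_pow I k.
Proof.
move=> Ip; apply: mem_ideal_gen; exists (fun=> p); split=> //.
by rewrite prodr_const card_ord.
Qed.

Lemma max_idealN1 : 1 \notin max_ideal K n.
Proof.
apply/negP => m1; have := @ideal_gen_min _ _
  [set p : S | p.@[fun=> 0] = 0]%classic _ _ _ m1; rewrite /= meval1.
move=> H; have /eqP := oner_neq0 K; apply; apply: H.
  split=> /= [|x y|a x]; rewrite ?meval0 ?mevalD ?mevalM //.
    by move=> -> ->; rewrite addr0.
  by move=> ->; rewrite mulr0.
by move=> _ [i ->]; rewrite mevalXU.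
Qed.

Lemma proper_sub_max_ideal I p : support_closed I -> 1 \notin I -> p \in I ->
  p \in max_ideal K n.
Proof.
move=> suppI nI1 Ip; rewrite (mpolyE p) big_seq.
apply: (@ideal_sum _ (ideal_set (max_ideal K n))) => [|u /(suppI _ _ Ip) Iu].
  exact: ideal_setP.
have [_ _ mM] := ideal_setP (max_ideal K n).
rewrite -mul_mpolyC; apply: (mM).
have [i ui] : exists i, u i != 0%N.
  apply: contrapT => u0; case/negP: nI1; rewrite -mpolyX0.
  suff <- : u = 0%MM by [].
  apply/mnmP => i; rewrite mnm0E; apply/eqP/negPn/negP => ui.
  by apply: u0; exists i.
have -> : u = (u - U_(i) + U_(i))%MM by rewrite submK // lep1mP.
by rewrite mpolyXD; apply: (mM); apply: mem_ideal_gen; exists i.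
Qed.

Section PowerMap.
Variable m : nat.
Hypothesis m_gt0 : (0 < m)%N.

Definition var_powers : n.-tuple S := [tuple 'X_i ^+ m | i < n].

Definition root_mnm u : 'X_{1..n} := [multinom (u i %/ m)%N | i < n].

Definition power_mnm u : bool := [forall i, (m %| u i)%N].

(** The retraction of the power map: it takes [m]-th roots of the monomials that
    are [m]-th powers and kills the others. Its coefficients are those of [p] at
    multiples of [m] ([mcoeff_root_part]), whence linearity. *)
Definition root_part p : S :=
  \sum_(u <- msupp p | power_mnm u) p@_u *: 'X_[root_mnm u].

Lemma power_mnmP u v : power_mnm u && (root_mnm u == v) = (u == v *+ m)%MM.
Proof.
apply/andP/eqP => [[/forallP mu /eqP <-]|->].
  by apply/mnmP => i; rewrite mulmnE mnmE divnK.
split; first by apply/forallP => i; rewrite mulmnE dvdn_mull.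
by apply/eqP/mnmP => i; rewrite mnmE mulmnE mulnK.
Qed.

Lemma mcoeff_root_part p v : (root_part p)@_v = p@_(v *+ m).
Proof.
rewrite {2}(mpolyE p) !raddf_sum big_mkcond /=; apply: eq_bigr => u _.
rewrite !mcoeffZ !mcoeffX -power_mnmP; case: ifP => //= _.
by rewrite mulr0.
Qed.

Lemma root_partB : {morph root_part : p q / p - q}.
Proof.
by move=> p q; apply/mpolyP => v; rewrite mcoeffB !mcoeff_root_part mcoeffB.
Qed.

Lemma root_part_linear c p q :
  root_part (c *: p + q) = c *: root_part p + root_part q.
Proof.
by apply/mpolyP => v; rewrite mcoeffD mcoeffZ !mcoeff_root_part mcoeffD mcoeffZ.
Qed.

Lemma root_part0 : root_part 0 = 0.
Proof. by rewrite /root_part msupp0 big_nil. Qed.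

Lemma comp_var_powersX u : 'X_[u] \mPo var_powers = 'X_[u *+ m].
Proof.
rewrite comp_mpolyX mpolyXE_id; apply: eq_bigr => i _.
by rewrite tnth_mktuple -exprM mulmnE mulnC.
Qed.

Lemma root_partX u :
  root_part 'X_[u] = if power_mnm u then 'X_[root_mnm u] else 0.
Proof.
apply/mpolyP => v; rewrite mcoeff_root_part mcoeffX -power_mnmP.
by case: ifP => _; rewrite /= ?mcoeffX ?mcoeff0.
Qed.

Lemma root_part1 : root_part 1 = 1.
Proof.
rewrite -mpolyX0 root_partX; have := power_mnmP 0%MM 0%MM.
have -> : (0 == 0 *+ m :> 'X_{1..n})%MM.
  by apply/eqP/mnmP => i; rewrite mulmnE mnm0E.
by move=> /andP[-> /eqP->].
Qed.

(** By linearity it suffices to consider monomials, where the point is that a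
    product with an [m]-th power is an [m]-th power only if the other factor
    is. *)
Lemma root_partM p q :
  root_part ((p \mPo var_powers) * q) = p * root_part q.
Proof.
elim/mpolyind: p => [|c u p _ _ IHp]; first by rewrite comp_mpoly0 !mul0r root_part0.
rewrite comp_mpolyD comp_mpolyZ comp_var_powersX !mulrDl -!scalerAl.
rewrite root_part_linear IHp; congr (_ *: _ + _).
elim/mpolyind: q {IHp} => [|d v q _ _ IHq].
  by rewrite mulr0 root_part0 mulr0.
rewrite mulrDr -scalerAr !root_part_linear IHq mulrDr -scalerAr.
congr (_ *: _ + _); rewrite -mpolyXD !root_partX.
have -> : power_mnm (u *+ m + v) = power_mnm v.
  by apply: eq_forallb => i; rewrite mnmDE mulmnE dvdn_addr ?dvdn_mull.
case: ifP => _; last by rewrite mulr0.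
rewrite -mpolyXD; congr 'X_[_]; apply/mnmP => i.
by rewrite [LHS]mnmE mnmDE mulmnE divnMDl // [RHS]mnmDE mnmE.
Qed.

(** The preimage under the power map of a prime that contains the powers of
    the variables contains the variables, so that primes not containing the
    maximal ideal have preimages with the same property. *)
Lemma prime_over_var_powers (P : set S) : is_prime P ->
    (forall p, p \in max_ideal K n -> P (p \mPo var_powers)) ->
  forall p, p \in max_ideal K n -> P p.
Proof.
move=> primeP Pm; apply: ideal_gen_min; first by have [] := primeP.
move=> _ [i ->]; apply: (prime_exp (k := m) primeP).
rewrite mpolyXn -comp_var_powersX; apply: Pm.
by apply: mem_ideal_gen; exists i.
Qed.

Lemma comp_var_powers_pow I p : support_closed I ->
  p \in I -> p \mPo var_powers \in ideal_pow I m.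
Proof.
move=> suppI Ip; rewrite comp_mpolyEX big_seq.
apply: (@ideal_sum _ (ideal_set (ideal_pow I m))) => [|u /(suppI _ _ Ip) Iu].
  exact: ideal_setP.
have [_ _ JM] := ideal_setP (ideal_pow I m).
rewrite comp_var_powersX -mpolyXn -mul_mpolyC.
by apply: JM; apply: exp_ideal_pow.
Qed.

(** The only use of integral closedness: a monomial whose [m]-th power lies in
    [I ^ m] is in the integral closure of [I]. *)
Lemma root_part_pow I p : support_closed I -> integrally_closed I ->
  p \in ideal_pow I m -> root_part p \in I.
Proof.
move=> suppI icI Jp; have [_ _ IM] := ideal_setP I.
rewrite /root_part big_seq_cond.
apply: (@ideal_sum _ (ideal_set I)) => [|u /andP[pu mu]].
  exact: ideal_setP.
rewrite -mul_mpolyC; apply: IM; rewrite /ideal_set /= icI.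
apply: mem_ideal_gen; exists (root_mnm u); split=> //; exists m; split=> //.
have := power_mnmP u (root_mnm u); rewrite mu eqxx => /esym/eqP uE.
by rewrite mpolyXn -uE; apply: support_closed_pow suppI _ _ Jp pu.
Qed.

End PowerMap.
End Monomial.

Theorem theorem4p6 (K : fieldType) (n : nat) (I : ideal {mpoly K[n]})
    (monI : monomial_ideal I) (icI : integrally_closed I)
    (m : nat) (hm : (1 <= m)%N) :
  depth_le (depth (quotmod (ideal_pow I m)) (max_ideal K n))
           (depth (quotmod I) (max_ideal K n)).
Proof.
have suppI := monomial_support_closed monI.
apply: depth_le_regular => [|l [s [<- ms]]]; first exact: ideal_pow_sub.
move=> /regular_seq_quotmod[regs n1].
have nI1 : 1 \notin I.
  apply/negP => I1; apply: n1; apply/adjoin_seqE; exists (fun=> 0).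
  rewrite big1 ?subr0 => [|i _]; last by rewrite mulr0.
  by rewrite -(expr1n _ m); apply: exp_ideal_pow.
have [t [szt mt regt]] := regular_mod_image
  (phi := comp_mpoly (var_powers K n m)) (@mpoly_noetherian K n)
  (ideal_setP (max_ideal K n)) (@prime_over_var_powers K n m)
  (ideal_setP (ideal_pow I m)) regs ms.
exists t; split=> //; apply/regular_seq_quotmod; split=> [|t1].
  apply: regular_mod_retract regt.
  - exact: root_partB hm.
  - exact: root_partM hm.
  - exact: root_part1 hm.
  - by move=> p; apply: comp_var_powers_pow suppI.
  - by move=> p; apply: (root_part_pow hm suppI icI).
case/negP: (max_idealN1 K n).
apply: (adjoin_seq_sub (ideal_setP (max_ideal K n)) _ mt t1) => p.
exact: proper_sub_max_ideal.
Qed.
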